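(* Let $I=[a,b]$ be a compact interval, let $g:I\to\mathbb R$ be a left-continuous, nondecreasing, pure-jump function with at least one positive jump, and let $\alpha>1$ and $L,R>0$. Put $A_{\alpha,g}(t)=\sum_{\tau\in[a,t)}[\Delta^+g(\tau)]^\alpha$ for $t\in I$, and define $F:I\to\mathcal K(\mathbb R)$ and $f:I\to\mathbb R$ by $$F(t)=L A_{\alpha,g}(t)+\{0,R\},\qquad f(t)=L A_{\alpha,g}(t).$$ Then $f$ is a selection of $F$ and $$[F]_{\alpha,g}=[f]_{\alpha,g}=L.$$ Moreover, for every $a\le s<t\le b$, $$d(f(s),f(t))=V(f;[s,t])=V_H(F;[s,t])=L\bigl(A_{\alpha,g}(t)-A_{\alpha,g}(s)\bigr),$$ and at every $a\le\tau<b$ with $\Delta^+g(\tau)>0$, $$J_f(\tau)=J_F(\tau)=L[\Delta^+g(\tau)]^\alpha.$$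
   Context: For $\tau\in[a,b)$, $\Delta^+g(\tau)=g(\tau+)-g(\tau)$ with $g(\tau+)=\lim_{r\downarrow\tau}g(r)$. A left-continuous nondecreasing $g$ is pure-jump if its Stieltjes measure is purely atomic, equivalently $g(t)-g(a)=\sum_{\tau\in[a,t)}\Delta^+g(\tau)$ for every $t\in I$. $\mathcal K(\mathbb R)$ is the family of nonempty compact subsets of $\mathbb R$ with Hausdorff distance $d_H$ induced by $d(x,y)=|x-y|$. A selection of $F$ is a map $f$ with $f(t)\in F(t)$ for all $t\in I$. $[F]_{\alpha,g}$ is the minimum $C\ge0$ with $d_H(F(s),F(t))\le C|g(t)-g(s)|^\alpha$ for all $s,t\in I$; $[f]_{\alpha,g}$ is the minimum $C\ge0$ with $d(f(s),f(t))\le C|g(t)-g(s)|^\alpha$ for all $s,t\in I$. $V_H(F;[s,t])=\sup_P\sum_{i=1}^n d_H(F(t_{i-1}),F(t_i))$ and $V(f;[s,t])=\sup_P\sum_{i=1}^n d(f(t_{i-1}),f(t_i))$ over all finite partitions $P:s=t_0<\cdots<t_n=t$. $F(\tau+)=\lim_{r\downarrow\tau}F(r)$ in $(\mathcal K(\mathbb R),d_H)$, $f(\tau+)=\lim_{r\downarrow\tau}f(r)$, $J_F(\tau)=d_H(F(\tau+),F(\tau))$, $J_f(\tau)=d(f(\tau+),f(\tau))$. *)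

(* Defs.v *)
From HB Require Import structures.
From mathcomp Require Import all_boot all_order all_algebra.
From mathcomp Require Import all_classical all_reals all_analysis.

Set Implicit Arguments.
Unset Strict Implicit.
Unset Printing Implicit Defensive.

Import Order.TTheory GRing.Theory Num.Theory.
Import numFieldNormedType.Exports.

Local Open Scope classical_set_scope.
Local Open Scope ring_scope.

(* The family K(R) of nonempty compact subsets of the real line. *)
Record compacts (R : realType) := Compacts {
  compacts_set :> set R ;
  compacts_compact : compact compacts_set ;
  compacts_neq0 : compacts_set !=set0 }.

Section hausdorff_distance.
Context {R : realType}.
Implicit Types (A B C : compacts R) (x y : R).

Definition point_dist x (B : set R) : R := inf [set `|x - y| | y in B].

Definition excess (A B : set R) : R := sup [set point_dist x B | x in A].

Definition hausdorff_dist (A B : set R) : R :=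
  Num.max (excess A B) (excess B A).

Lemma compacts_ext A B : compacts_set A = compacts_set B -> A = B.
Proof.
case: A B => [A cA A0] [B cB B0] /= AB; rewrite AB in cA A0 *.
by congr Compacts; exact: Prop_irrelevance.
Qed.

Lemma point_dist_le x y (B : set R) : B y -> point_dist x B <= `|x - y|.
Proof.
move=> By; apply: ge_inf; last by exists y.
by exists 0 => _ [z _ <-].
Qed.

Lemma point_dist_ge0 x B : 0 <= point_dist x B.
Proof.
apply: lb_le_inf; last by move=> _ [z _ <-].
by have [y By] := compacts_neq0 B; exists `|x - y|, y.
Qed.

Lemma point_dist_adherent x B (e : R) : 0 < e ->
  exists2 y, compacts_set B y & `|x - y| < point_dist x B + e.
Proof.
move=> e0; have [|_ [y By <-] ?] := @inf_adherent _ [set `|x - y| | y in B] _ e0.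
  split; last by exists 0 => _ [z _ <-].
  by have [y By] := compacts_neq0 B; exists `|x - y|, y.
by exists y.
Qed.

Lemma excess_ge x A B : compacts_set A x -> point_dist x B <= excess A B.
Proof.
move=> Ax; apply: ub_le_sup; last by exists x.
have [M [Mreal AM]] := compact_bounded (@compacts_compact _ A).
have [y By] := compacts_neq0 B.
exists (M + 1 + `|y|) => _ [z Az <-].
rewrite (le_trans (point_dist_le z By))// (le_trans (ler_normB _ _))// lerD2r.
by apply: AM => //; rewrite ltrDl.
Qed.

Lemma excess_le A B c : (forall x, compacts_set A x -> point_dist x B <= c) ->
  excess A B <= c.
Proof.
move=> Ac; apply: ge_sup; last by move=> _ [x Ax <-]; exact: Ac.
by have [x Ax] := compacts_neq0 A; exists (point_dist x B), x.
Qed.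

Lemma excess_ge0 A B : 0 <= excess A B.
Proof.
have [x Ax] := compacts_neq0 A.
exact: le_trans (point_dist_ge0 x B) (excess_ge _ Ax).
Qed.

Lemma excess_triangle B A C : excess A C <= excess A B + excess B C.
Proof.
apply: excess_le => x Ax; apply/ler_addgt0Pr => e e0.
have [y By xy] := point_dist_adherent x B e0.
have [z Cz yz] := point_dist_adherent y C e0.
have xC : point_dist x C <= `|x - y| + point_dist y C.
  apply/ler_addgt0Pr => d d0; have [w Cw yw] := point_dist_adherent y C d0.
  rewrite (le_trans (point_dist_le x Cw))// (le_trans (ler_distD y _ _))//.
  by rewrite -addrA lerD2l ltW.
rewrite (le_trans xC)// addrAC lerD ?excess_ge// (le_trans (ltW xy))//.
by rewrite lerD2r excess_ge.
Qed.

Lemma excess_eq0 A B : excess A B <= 0 -> A `<=` B.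
Proof.
move=> AB x Ax.
apply: (compact_closed (@Rhausdorff R) (@compacts_compact _ B)) => U.
rewrite -nbhs_ballE => -[e /= e0 xeU].
have [y By xy] := point_dist_adherent x B e0.
exists y; split => //; apply: xeU; rewrite /ball/= (lt_le_trans xy)//.
by rewrite -[leRHS]add0r lerD2r (le_trans (excess_ge _ Ax)).
Qed.

Let dH A B := hausdorff_dist A B.

Let dHxx A : dH A A = 0.
Proof.
rewrite /dH /hausdorff_dist maxxx; apply/eqP; rewrite eq_le excess_ge0 andbT.
apply: excess_le => x Ax.
by rewrite (le_trans (point_dist_le x Ax))// subrr normr0.
Qed.

Let dH_positivity A B : dH A B = 0 -> A = B.
Proof.
move=> AB; apply: compacts_ext; apply/seteqP.
by split; apply: excess_eq0; rewrite -AB /dH /hausdorff_dist le_max lexx ?orbT.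
Qed.

Let dH_sym A B : dH A B = dH B A.
Proof. exact: maxC. Qed.

Let dH_triangle B A C : dH A C <= dH A B + dH B C.
Proof.
rewrite /dH /hausdorff_dist ge_max; apply/andP; split.
  by rewrite (le_trans (excess_triangle B _ _))// lerD// le_max lexx.
rewrite (le_trans (excess_triangle B _ _))// addrC lerD// le_max lexx ?orbT//.
Qed.

HB.instance Definition _ := gen_eqMixin (compacts R).
HB.instance Definition _ := gen_choiceMixin (compacts R).
HB.instance Definition _ :=
  @isMetric.Build R (compacts R) dH dHxx dH_positivity dH_sym dH_triangle.

End hausdorff_distance.

Section compact_constructions.
Context {R : realType}.

Lemma compact_pair (x y : R) : compact [set x; y].
Proof. by apply: compactU; exact: compact_set1. Qed.

Lemma pair_neq0 (x y : R) : [set x; y] !=set0.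
Proof. by exists x; left. Qed.

Definition pair_compacts (x y : R) : compacts R :=
  Compacts (@compact_pair x y) (@pair_neq0 x y).

Lemma compact_translate (c : R) (K : compacts R) :
  compact [set c + x | x in K].
Proof.
apply: continuous_compact (@compacts_compact _ K).
by apply: continuous_subspaceT => x; apply: cvgD; [exact: cvg_cst|exact: cvg_id].
Qed.

Lemma translate_neq0 (c : R) (K : compacts R) : [set c + x | x in K] !=set0.
Proof. by have [x Kx] := compacts_neq0 K; exists (c + x), x. Qed.

Definition translate_compacts (c : R) (K : compacts R) : compacts R :=
  Compacts (@compact_translate c K) (@translate_neq0 c K).

End compact_constructions.

Section metric_valued_maps.
Context {R : realType} {T : metricType R}.
Implicit Types (F : R -> T) (a b s t alpha : R).

(* The constants C >= 0 such that F is (alpha, g)-Hoelder on [a, b] with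
   constant C; the seminorm [F]_{alpha,g} is the minimum of this set. *)
Definition holder_constants a b (g : R -> R) alpha F : set R :=
  [set C | 0 <= C /\ forall s t, s \in `[a, b] -> t \in `[a, b] ->
    mdist (F s) (F t) <= C * (`|g t - g s| `^ alpha)].

(* The analogue of [total_variation] for maps into a metric space; as there,
   a partition s = t_0 < ... < t_n = t is represented by [t_1; ...; t_n]. *)
Definition metric_variation s t F : \bar R :=
  ereal_sup [set (\sum_(0 <= i < size p)
      mdist (F (nth t (s :: p) i)) (F (nth t (s :: p) i.+1)))%:E
    | p in itv_partition s t].

(* The right limit F(tau+) exists in T and d(F(tau+), F(tau)) = j; the limit is
   unique by [metric_hausdorff]. *)
Definition has_right_jump F (tau j : R) : Prop :=
  exists2 l : T, F r @[r --> tau^'+] --> l & mdist l (F tau) = j.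

End metric_valued_maps.

Definition is_minimum {R : realType} (S : set R) (m : R) : Prop :=
  S m /\ lbound S m.

Section pure_jump_functions.
Context {R : realType}.
Implicit Types (g : R -> R) (a b t tau alpha : R).

Definition jump g tau : R := lim (g r @[r --> tau^'+]) - g tau.

(* For left-continuous nondecreasing g: the Stieltjes measure of g, which gives
   [a, t[ the mass g t - g a, is purely atomic on [a, b[. *)
Definition pure_jump a b g : Prop := forall t, t \in `[a, b] ->
  \esum_(tau in [set` `[a, t[]) (jump g tau)%:E = (g t - g a)%:E.

(* For t in [a, b], the esum is finite when g is nondecreasing on [a, b] and
   1 <= alpha, so that [fine] loses no information there. *)
Definition jump_power_sum a alpha g t : R :=
  fine (\esum_(tau in [set` `[a, t[]) (jump g tau `^ alpha)%:E).

End pure_jump_functions.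

(* Main.v *)
(** Translating a compact set [K] is an isometry of [R] into (K(R), d_H), so
    every metric quantity attached to [F] equals the one attached to [f].  For
    a pure-jump [g], [A t - A s] is the sum of the [alpha]-th powers of the
    jumps in [s, t[, which add up to [S = g t - g s]; each of them is at most
    [S], so [x ^ alpha <= x * S ^ (alpha - 1)] and summing gives
    [A t - A s <= S ^ alpha].  Conversely [A t - A tau] contains the term
    [jump tau ^ alpha].  As [t] decreases to [tau] both bounds meet at
    [jump tau ^ alpha]: this gives the jump of [f] and, at any positive jump,
    the sharpness of the constant [L]. *)
Require Import Defs.
From HB Require Import structures.
From mathcomp Require Import all_boot all_order all_algebra.
From mathcomp Require Import all_classical all_reals all_analysis.
From mathcomp Require Import ring lra.

Set Implicit Arguments.
Unset Strict Implicit.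
Unset Printing Implicit Defensive.

Import Order.TTheory GRing.Theory Num.Theory.
Import numFieldNormedType.Exports.
Local Open Scope classical_set_scope.
Local Open Scope ring_scope.

(** * Hausdorff distance between translates of a compact set *)

Lemma mdist_translate (R : realType) (K : compacts R) (x y : R) :
  mdist (translate_compacts x K) (translate_compacts y K) = `|y - x|.
Proof.
have excess_translate_le (u v : R) :
    excess (translate_compacts u K) (translate_compacts v K) <= `|v - u|.
  apply: excess_le => _ [z Kz <-].
  have vz : compacts_set (translate_compacts v K) (v + z) by exists z.
  rewrite (le_trans (point_dist_le _ vz))//.
  by rewrite opprD addrACA subrr addr0 distrC.
wlog xy : x y / x <= y.
  move=> h; have [/h//|/ltW/h yx] := leP x y.
  by rewrite metric_sym yx distrC.
apply/eqP; rewrite eq_le; apply/andP; split.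
  by rewrite ge_max excess_translate_le distrC excess_translate_le.
(* For the lower bound, compare at the bottom of [K]: as [x <= y], every point of [y + K] is at
   least [y + inf K], so [x + z] with [z < inf K + e] lies at distance more than [y - x - e] from
   it. *)
have infK : has_inf K.
  split; first exact: compacts_neq0.
  have [M [Mreal KM]] := compact_bounded (@compacts_compact _ K).
  exists (- (M + 1)) => z Kz.
  by rewrite lerNl (le_trans (ler_norm _))// normrN KM// ltrDl.
rewrite ger0_norm ?subr_ge0//; apply/ler_addgt0Pr => e e0.
have [z Kz ze] := inf_adherent e0 infK.
have xz : compacts_set (translate_compacts x K) (x + z) by exists z.
apply: (@le_trans _ _ (point_dist (x + z) (translate_compacts y K) + e));
  last by rewrite lerD2r (le_trans (excess_ge _ xz))// le_max lexx.
rewrite -lerBlDr; apply: lb_le_inf.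
  by exists `|x + z - (y + z)|, (y + z) => //; exists z.
move=> _ [_ [w Kw <-] <-].
have infw : inf K <= w by apply: ge_inf => //; case: infK.
rewrite distrC (le_trans _ (ler_norm _))//; lra.
Qed.

Lemma cvg_translate (R : realType) (K : compacts R) (T : Type)
    (H : set_system T) (FH : Filter H) (f : T -> R) (l : R) :
  f r @[r --> H] --> l ->
  translate_compacts (f r) K @[r --> H] --> translate_compacts l K.
Proof.
move=> fl; apply/metricType_numDomainType.cvgrPdist_lt => e e0.
near=> r; rewrite mdist_translate distrC; near: r.
exact: cvgr_dist_lt.
Unshelve. all: by end_near. Qed.

(** The order [f y - f x] is that of the increments in [variation], so the two sums agree term by
    term on each partition. *)
Lemma metric_variationE (R : realType) (T : metricType R) (F : R -> T)
    (f : R -> R) (s t : R) : (forall x y, mdist (F x) (F y) = `|f y - f x|) ->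
  metric_variation s t F = total_variation s t f.
Proof.
move=> Ff; congr ereal_sup; rewrite /variations image_comp.
apply: eq_imagel => p _ /=.
by congr EFin; apply: eq_bigr => i _; rewrite Ff.
Qed.

(** * Sums of powers with exponent at least 1 *)

Lemma esum_powR_le (R : realType) (T : choiceType) (D : set T) (x : T -> R)
    (S alpha : R) : 1 <= alpha -> (forall i, D i -> 0 <= x i) ->
  \esum_(i in D) (x i)%:E = S%:E ->
  (\esum_(i in D) (x i `^ alpha)%:E <= (S `^ alpha)%:E)%E.
Proof.
move=> alpha1 x0 xS.
have S0 : 0 <= S.
  by rewrite -lee_fin -xS esum_ge0// => i Di; rewrite lee_fin x0.
have sum_le X : fsets D X -> \sum_(i \in X) x i <= S.
  move=> [finX XD]; rewrite -lee_fin -xS -fsumEFin//.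
  by apply: ereal_sup_ubound; exists X.
(* A singleton is a finite subset of [D], so [x i] is itself one of the subsums bounded by [S]. *)
have x_le i : D i -> x i <= S.
  move=> Di; rewrite -[leLHS](fsbig_set1 (GRing.add : _ -> _ -> R) i x).
  by apply: sum_le; split; [exact: finite_set1|move=> _ ->].
apply: ge_ereal_sup => _ [X [finX XD] <-]; rewrite fsumEFin// lee_fin.
have alpha0 : 0 < alpha by rewrite (lt_le_trans _ alpha1).
rewrite -(mulr_powRB1 S0 alpha0).
apply: (@le_trans _ _ (\sum_(i \in X) S `^ (alpha - 1) * x i)).
  rewrite -lee_fin -!fsumEFin//; apply: lee_fsum => // i Xi.
  have Di := XD _ Xi; rewrite lee_fin.
  rewrite -(mulr_powRB1 (x0 _ Di) alpha0) mulrC ler_wpM2r ?x0//.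
  by rewrite ge0_ler_powR ?nnegrE ?subr_ge0 ?x0 ?x_le.
by rewrite -mulr_fsumr mulrC ler_wpM2r ?powR_ge0// sum_le.
Qed.

(** * Right jumps of [g] and increments of the power sum *)

Section pure_jump.
Context {R : realType} (a b : R) (g : R -> R).
Context (g_nondecreasing : {in `[a, b] &, {homo g : s t / s <= t}}).
Implicit Types s t tau : R.

(** This makes the [lim] in [jump] a genuine limit: on a right neighbourhood of [tau] inside
    [[a, b]], [g] is monotone and bounded below by [g tau]. *)
Lemma jump_cvg tau : tau \in `[a, b[ ->
  g r - g tau @[r --> tau^'+] --> jump g tau.
Proof.
rewrite in_itv/= => /andP[atau taub].
apply: cvgB; last exact: cvg_cst.
apply: nondecreasing_at_right_is_cvgr.
  near=> c; move=> x y; rewrite !in_itv/= => /andP[taux xc] /andP[tauy yc].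
  have cb : c <= b by near: c; exact: nbhs_right_ltW.
  by apply: g_nondecreasing; rewrite in_itv/=; apply/andP; split; lra.
near=> c; exists (g tau) => _ /= [x + <-]; rewrite in_itv/= => /andP[taux xc].
have cb : c <= b by near: c; exact: nbhs_right_ltW.
by apply: g_nondecreasing; rewrite ?in_itv/=; lra.
Unshelve. all: by end_near. Qed.

Lemma jump_ge0 tau : tau \in `[a, b[ -> 0 <= jump g tau.
Proof.
move=> tauab; have /andP[atau taub] : a <= tau < b by rewrite in_itv in tauab.
apply: (cvgr_to_ge (jump_cvg tauab)); near=> r.
have taur : tau < r by near: r; exact: nbhs_right_gt.
have rb : r <= b by near: r; exact: nbhs_right_ltW.
by rewrite subr_ge0; apply: g_nondecreasing; rewrite ?in_itv/=; lra.
Unshelve. all: by end_near. Qed.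

Context (g_pure_jump : pure_jump a b g).

Lemma esum_itv_split (h : R -> \bar R) s t : a <= s -> s <= t ->
  (forall tau, tau \in `[a, t[ -> 0 <= h tau)%E ->
  (\esum_(tau in [set` `[a, t[]) h tau = \esum_(tau in [set` `[a, s[]) h tau +
    \esum_(tau in [set` `[s, t[]) h tau)%E.
Proof.
move=> as_ st h0; rewrite (esumID [set` `[a, s[])//.
congr (_ + _)%E; congr esum; apply/seteqP; split=> x /=;
  rewrite !in_itv/=; lra.
Qed.

(** [pure_jump] only covers intervals that start at [a]; additivity moves the left end to [s]. *)
Lemma esum_jump s t : a <= s -> s <= t -> t <= b ->
  \esum_(tau in [set` `[s, t[]) (jump g tau)%:E = (g t - g s)%:E.
Proof.
move=> as_ st tb.
have := @g_pure_jump t; rewrite in_itv/= (le_trans as_ st) tb => /(_ isT).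
rewrite (@esum_itv_split _ s)//; last first.
  move=> tau; rewrite in_itv/= => /andP[atau taut].
  by rewrite lee_fin jump_ge0// in_itv/= atau (lt_le_trans taut).
rewrite g_pure_jump ?in_itv/= ?as_ ?(le_trans st)// => /eqP.
(* Cancelling in the extended reals is legitimate because [g s - g a] is finite. *)
rewrite addeC eq_sym -sube_eq//; last exact: fin_num_adde_defl.
by move=> /eqP <-; rewrite -EFinB; congr EFin; ring.
Qed.

Context (alpha : R) (alpha_ge1 : 1 <= alpha).
Local Notation A := (jump_power_sum a alpha g).

Lemma esum_jump_powR_le s t : a <= s -> s <= t -> t <= b ->
  (\esum_(tau in [set` `[s, t[]) (jump g tau `^ alpha)%:E <=
    ((g t - g s) `^ alpha)%:E)%E.
Proof.
move=> as_ st tb; apply: esum_powR_le => //; last exact: esum_jump.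
move=> tau /=; rewrite in_itv/= => /andP[stau taut].
by apply: jump_ge0; rewrite in_itv/= (le_trans as_ stau) (lt_le_trans taut tb).
Qed.

Lemma jump_power_sumB s t : a <= s -> s <= t -> t <= b ->
  (A t - A s)%:E = \esum_(tau in [set` `[s, t[]) (jump g tau `^ alpha)%:E.
Proof.
move=> as_ st tb.
(* [fine] sends infinite values to 0; comparison with the finite bound on power sums rules this out,
   so splitting at [s] survives [fine]. *)
have fin u v : a <= u -> u <= v -> v <= b ->
    \esum_(tau in [set` `[u, v[]) (jump g tau `^ alpha)%:E \is a fin_num.
  move=> au uv vb; rewrite ge0_fin_numE.
    exact: le_lt_trans (esum_jump_powR_le au uv vb) (ltry _).
  by apply: esum_ge0 => tau _; rewrite lee_fin powR_ge0.
rewrite /jump_power_sum (@esum_itv_split _ s t)// => [|tau _]; last first.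
  by rewrite lee_fin powR_ge0.
rewrite fineD ?fin//; last exact: le_trans tb.
by rewrite addrAC subrr add0r fineK// fin.
Qed.

Lemma jump_power_sum_le s t : a <= s -> s <= t -> t <= b -> A s <= A t.
Proof.
move=> as_ st tb; rewrite -subr_ge0 -lee_fin jump_power_sumB// esum_ge0//.
by move=> tau _; rewrite lee_fin powR_ge0.
Qed.

Lemma jump_power_sumB_le s t : a <= s -> s <= t -> t <= b ->
  A t - A s <= (g t - g s) `^ alpha.
Proof.
by move=> as_ st tb; rewrite -lee_fin jump_power_sumB// esum_jump_powR_le.
Qed.

Lemma jump_powR_le tau t : a <= tau -> tau < t -> t <= b ->
  jump g tau `^ alpha <= A t - A tau.
Proof.
move=> atau taut tb; rewrite -lee_fin jump_power_sumB ?(ltW taut)//.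
apply: esum_ge; exists [set tau]; last by rewrite fsbig_set1.
split; first exact: finite_set1.
by move=> _ ->; rewrite /= in_itv/= lexx.
Qed.

(** A positive jump puts the limit where [powR] is differentiable in its base, hence continuous. *)
Lemma jump_powR_cvg tau : tau \in `[a, b[ -> 0 < jump g tau ->
  (g r - g tau) `^ alpha @[r --> tau^'+] --> jump g tau `^ alpha.
Proof.
move=> tauab jump0; pose h (x : R) := x `^ alpha.
apply: (@continuous_cvg _ _ _ _ _ _ h _ _ (jump_cvg tauab)).
apply: differentiable_continuous; apply/derivable1_diffP.
by apply: derivable_powR; rewrite in_itv/= jump0.
Qed.

Lemma jump_power_sum_cvg tau : tau \in `[a, b[ -> 0 < jump g tau ->
  A r @[r --> tau^'+] --> A tau + jump g tau `^ alpha.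
Proof.
move=> tauab jump0; have /andP[atau taub] : a <= tau < b.
  by rewrite in_itv in tauab.
have powRD_cvg : A tau + (g r - g tau) `^ alpha @[r --> tau^'+] -->
    A tau + jump g tau `^ alpha.
  by apply: cvgD; [exact: cvg_cst|exact: jump_powR_cvg].
apply: (squeeze_cvgr _ (cvg_cst _) powRD_cvg); near=> r.
have taur : tau < r by near: r; exact: nbhs_right_gt.
have rb : r <= b by near: r; exact: nbhs_right_ltW.
apply/andP; split; first by rewrite -lerBrDl jump_powR_le.
by rewrite -lerBlDl jump_power_sumB_le// ltW.
Unshelve. all: by end_near. Qed.

End pure_jump.

(* MathComp-Analysis.  The real parameter R > 0 of the two-point set {0, R} is
   called rho here.  Maps on I = [a, b] are total functions of which only the
   values on [a, b] are constrained or used. *)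
Theorem proposition10p3 (R : realType) (a b : R) (g : R -> R)
    (alpha L rho : R)
    (ab : a <= b)
    (g_nondecreasing : {in `[a, b] &, {homo g : s t / s <= t}})
    (g_left_continuous :
      forall t : R, t \in `]a, b] -> g r @[r --> t^'-] --> g t)
    (g_pure_jump : pure_jump a b g)
    (g_has_jump : exists2 tau : R, tau \in `[a, b[ & 0 < jump g tau)
    (alpha_gt1 : 1 < alpha) (L_gt0 : 0 < L) (rho_gt0 : 0 < rho) :
  let A : R -> R := jump_power_sum a alpha g in
  let F : R -> compacts R :=
    fun t => translate_compacts (L * A t) (pair_compacts 0 rho) in
  let f : R -> R^o := fun t => L * A t in
  [/\ forall t : R, t \in `[a, b] -> compacts_set (F t) (f t),
      is_minimum (holder_constants a b g alpha F) L,
      is_minimum (holder_constants a b g alpha f) L,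
      forall s t : R, a <= s -> s < t -> t <= b ->
        [/\ mdist (f s) (f t) = L * (A t - A s),
            total_variation s t f = (L * (A t - A s))%:E &
            metric_variation s t F = (L * (A t - A s))%:E] &
      forall tau : R, tau \in `[a, b[ -> 0 < jump g tau ->
        has_right_jump f tau (L * jump g tau `^ alpha) /\
        has_right_jump F tau (L * jump g tau `^ alpha)].
Proof.
move=> A F f.
have alpha_ge1 := ltW alpha_gt1.
have mdistF s t : mdist (F s) (F t) = `|f t - f s| by exact: mdist_translate.
have f_mono s t : a <= s -> s <= t -> t <= b -> f s <= f t.
  by move=> *; rewrite ler_pM2l//; exact: (jump_power_sum_le g_nondecreasing).
have holderF : holder_constants a b g alpha F = holder_constants a b g alpha f.
  rewrite /holder_constants; under eq_fun do
    under eq_forall do under eq_forall do rewrite mdistF.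
  (* The rest holds by conversion: on [R^o], [mdist x y] unfolds to the absolute value of
     [y - x]. *)
  by [].
have f_cvg tau : tau \in `[a, b[ -> 0 < jump g tau ->
    f r @[r --> tau^'+] --> f tau + L * jump g tau `^ alpha.
  move=> tauab jump0; rewrite -mulrDr; apply: cvgM; first exact: cvg_cst.
  exact: (jump_power_sum_cvg g_nondecreasing).
have holderL : is_minimum (holder_constants a b g alpha f) L.
  split.
    split=> [|s t sab tab]; first exact: ltW.
    wlog st : s t sab tab / s <= t.
      move=> h; have [/h->//|/ltW/h ts] := leP s t.
      by rewrite metric_sym (distrC (g t)) ts.
    move: sab tab; rewrite !in_itv/= => /andP[as_ sb] /andP[at_ tb].
    have gst : g s <= g t.
      by apply: g_nondecreasing; rewrite ?in_itv/= ?as_ ?at_.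
    rewrite [mdist _ _]ger0_norm ?subr_ge0 ?f_mono//.
    rewrite ger0_norm ?subr_ge0// -mulrBr ler_pM2l//.
    exact: (jump_power_sumB_le g_nondecreasing).
  move=> C [C0 HC]; have [tau tauab jump0] := g_has_jump.
  have /andP[atau taub] : a <= tau < b by rewrite in_itv in tauab.
  (* Multiplied by the positive power of the jump, [L <= C] becomes the limit, as [r] decreases to
     [tau], of the Hölder bound on [f r - f tau], which is itself at least [L] times that power. *)
  rewrite -(ler_pM2r (powR_gt0 alpha jump0)).
  have HC_cvg : C * (g r - g tau) `^ alpha @[r --> tau^'+] -->
      C * jump g tau `^ alpha.
    apply: cvgM; first exact: cvg_cst.
    exact: (jump_powR_cvg g_nondecreasing).
  apply: (cvgr_to_ge HC_cvg); near=> r.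
  have taur : tau < r by near: r; exact: nbhs_right_gt.
  have rb : r <= b by near: r; exact: nbhs_right_ltW.
  have gr : g tau <= g r by apply: g_nondecreasing; rewrite ?in_itv/=; lra.
  have := HC tau r; rewrite !in_itv/= atau rb ltW// (le_trans atau (ltW taur)).
  move=> /(_ isT isT); rewrite (ger0_norm (_ : 0 <= g r - g tau)) ?subr_ge0//.
  apply: le_trans; rewrite [mdist _ _]ger0_norm; last first.
    by rewrite subr_ge0 f_mono// ltW.
  rewrite -mulrBr ler_pM2l//.
  exact: (jump_powR_le g_nondecreasing).
split.
- by move=> t _; exists 0; [left|rewrite addr0].
- by rewrite holderF.
- exact: holderL.
- move=> s t as_ st tb.
  have TV : total_variation s t f = (L * (A t - A s))%:E.
    rewrite nondecreasing_total_variation ?ltW// ?mulrBr//.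
    move=> x y; rewrite !in_itv/= => /andP[sx xt] /andP[sy yt] xy.
    by apply: f_mono => //; lra.
  split => //; last by rewrite (metric_variationE _ _ mdistF).
  by rewrite mulrBr [LHS]ger0_norm// subr_ge0 f_mono// ltW.
- move=> tau tauab jump0; have jump_powR0 : 0 <= L * jump g tau `^ alpha.
    by rewrite mulr_ge0 ?powR_ge0 ?ltW.
  (* The limit of [F] is the translate by the right limit of [f], since translation is continuous in
     its offset. *)
  split; [exists (f tau + L * jump g tau `^ alpha)|
    exists (translate_compacts (f tau + L * jump g tau `^ alpha)
                               (pair_compacts 0 rho))].
  + exact: f_cvg.
  + by rewrite metric_sym [LHS]ger0_norm addrAC subrr add0r.
  + by apply: cvg_translate; exact: f_cvg.
  + by rewrite mdist_translate distrC addrAC subrr add0r ger0_norm.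
Unshelve. all: by end_near. Qed.
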